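(* Let $\mathcal{R}$ be a unital commutative ring, $1\in\mathcal{B}\subset\mathcal{A}$ an inclusion of unital $\mathcal{R}$-algebras, $m\in\mathbb{Z}_{\geq1}$, $d\in[m]$, let $(s,t),(u,v)\in[m-d]\times[d]$, and let $\pi\in Gr^{(m-d;m)}_{1}(\mathcal{A})$. Assume that the nc set $\widetilde{\rho}^{(d;m)}(\pi;\mathcal{B})$ over $Gr^{(d;m)}(\mathcal{B})$ is $(s,t)$-admissible. Then $$\left(\widetilde{\Delta}^{(d;m)}_{s,t}\widetilde{\mathfrak{R}}^{(d;m)}(\pi;\mathcal{B}|v,u)\right)(\sigma;\sigma')(X)=-\widetilde{\mathfrak{R}}^{(d;m)}(\pi;\mathcal{B}|v,s)(\sigma)\cdot X\cdot \widetilde{\mathfrak{R}}^{(d;m)}(\pi;\mathcal{B}|t,u)(\sigma')$$ for any $n,n'\in\mathbb{Z}_{\geq1}$, $\sigma\in\widetilde{\rho}^{(d;m)}_{n}(\pi;\mathcal{B})$, $\sigma'\in\widetilde{\rho}^{(d;m)}_{n'}(\pi;\mathcal{B})$ and $X\in M_{n,n'}(\mathcal{B})$.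
   Context: Notation: $[k]=\{1,\dots,k\}$; scalars in $\mathcal{R}$ act centrally on algebras. For an $\mathcal{R}$-module $\mathcal{M}$, $M_{n,n'}(\mathcal{M})$ denotes $n\times n'$ matrices over $\mathcal{M}$, $M_n(\mathcal{M})=M_{n,n}(\mathcal{M})$, $M(\mathcal{M})=\bigsqcup_{n\geq1}M_n(\mathcal{M})$. For a unital $\mathcal{R}$-algebra $\mathcal{C}$, an element $A\in M_m(M_n(\mathcal{C}))$ is an $m\times m$ block matrix $[A_{i,j}]$ with $A_{i,j}\in M_n(\mathcal{C})$. The nc Grassmannian: for $e\in[m]$, let $H^{(e;m)}_n(\mathcal{C})$ be the set of block matrices $\begin{bmatrix} X & 0 \\ Y & Z \end{bmatrix}$ with $X\in GL_{m-e}(M_n(\mathcal{C}))$, $Y\in M_{e,m-e}(M_n(\mathcal{C}))$, $Z\in GL_e(M_n(\mathcal{C}))$. For $A,B\in GL_m(M_n(\mathcal{C}))$ write $A\sim^{(e;m)}_nB$ iff $A=B\Gamma$ for some $\Gamma\in H^{(e;m)}_n(\mathcal{C})$. Put $Gr^{(e;m)}_n(\mathcal{C})=GL_m(M_n(\mathcal{C}))/\sim^{(e;m)}_n$, $Gr^{(e;m)}(\mathcal{C})=\bigsqcup_{n\geq1}Gr^{(e;m)}_n(\mathcal{C})$. Operations (well defined): $A\widetilde{\oplus}A'$ for $A\in M_m(M_n(\mathcal{C}))$, $A'\in M_m(M_{n'}(\mathcal{C}))$ is the element of $M_m(M_{n+n'}(\mathcal{C}))$ with $(i,j)$ block $A_{i,j}\oplus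 A'_{i,j}$; $a^{\widetilde{\oplus}n}$ is the $n$-fold iterate. $\sigma\oplus\sigma'$ is the class of $A\widetilde{\oplus}A'$ for $A\in\sigma,A'\in\sigma'$; $\pi^{\oplus n}$ is the $n$-fold direct sum. For $s\in GL_n(\mathcal{R})$, $s\cdot\sigma$ is the class of $s^{\oplus m}A$, $A\in\sigma$, where $s^{\oplus m}$ is block diagonal with $m$ blocks $s$. nc sets and functions: an nc set over $Gr^{(d;m)}(\mathcal{B})$ is $\Omega=\bigsqcup_n\Omega_n$ with $\Omega_n\subset Gr^{(d;m)}_n(\mathcal{B})$ and $\Omega_n\oplus\Omega_{n'}\subset\Omega_{n+n'}$. A function $f:\Omega\to M(\mathcal{N})$ ($\mathcal{N}$ an $\mathcal{R}$-module) is nc if $f(\Omega_n)\subset M_n(\mathcal{N})$, $f(\sigma\oplus\sigma')=f(\sigma)\oplus f(\sigma')$, and $f(s\cdot\sigma)=sf(\sigma)s^{-1}$ whenever $\sigma\in\Omega_n$, $s\in GL_n(\mathcal{R})$, $s\cdot\sigma\in\Omega_n$. Difference-differential operator: for $(p,q)\in[m-d]\times[d]$, $\sigma\in Gr^{(d;m)}_n(\mathcal{B})$, $\sigma'\in Gr^{(d;m)}_{n'}(\mathcal{B})$, $X\in M_{n,n'}(\mathcal{B})$, let $(\sigma;\sigma')_{p,q}(X)\in Gr^{(d;m)}_{n+n'}(\mathcal{B})$ be the class (independent of $A\in\sigma$, $A'\in\sigma'$) of $$A\widetilde{\oplus}A'+\sum_{j=1}^{d}\begin{bmatrix} 0_n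 & XA'_{q,m-d+j} \\ 0_{n',n} & 0_{n'} \end{bmatrix}\otimes e^{(m)}_{d+p,m-d+j},$$ where $e^{(m)}_{i,j}$ is the $m\times m$ matrix unit (so the displayed matrix is added in block position $(d+p,m-d+j)$). An nc set $\Omega$ over $Gr^{(d;m)}(\mathcal{B})$ is $(p,q)$-admissible if for all $\sigma\in\Omega_n$, $\sigma'\in\Omega_{n'}$, $X\in M_{n,n'}(\mathcal{B})$ there is an invertible $r\in\mathcal{R}$ with $(\sigma;\sigma')_{p,q}(rX)\in\Omega_{n+n'}$. For an nc function $f$ on such $\Omega$, one has $f((\sigma;\sigma')_{p,q}(rX))=\begin{bmatrix} f(\sigma) & H \\ 0 & f(\sigma') \end{bmatrix}$ for a unique $H\in M_{n,n'}(\mathcal{N})$, and $(\widetilde{\Delta}^{(d;m)}_{p,q}f)(\sigma;\sigma')(X):=r^{-1}H$, which does not depend on the choice of $r$. Resolvent set and resolvent: for $A,B\in M_m(M_n(\mathcal{A}))$ let $r^{(d;m)}(A;B)\in M_m(M_n(\mathcal{A}))$ be the block matrix whose first $m-d$ block columns are the block columns $d+1,\dots,m$ of $A$ and whose last $d$ block columns are the block columns $m-d+1,\dots,m$ of $B$. For $\pi\in Gr^{(m-d;m)}_1(\mathcal{A})$, $\widetilde{\rho}^{(d;m)}_n(\pi;\mathcal{B})$ is the set of $\sigma\in Gr^{(d;m)}_n(\mathcal{B})$ such that $r^{(d;m)}(A;B)$ is invertible in $M_m(M_n(\mathcal{A}))$ for some (equivalently all) $A\in\pi^{\oplus n}$,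 $B\in\sigma$; $\widetilde{\rho}^{(d;m)}(\pi;\mathcal{B})=\bigsqcup_n\widetilde{\rho}^{(d;m)}_n(\pi;\mathcal{B})$. This is an nc set over $Gr^{(d;m)}(\mathcal{B})$. For $(u,v)\in[m-d]\times[d]$ define $\widetilde{\mathfrak{R}}^{(d;m)}(\pi;\mathcal{B}|v,u):\widetilde{\rho}^{(d;m)}(\pi;\mathcal{B})\to M(\mathcal{A})$ by $$\widetilde{\mathfrak{R}}^{(d;m)}(\pi;\mathcal{B}|v,u)(\sigma)=[B_{v,m-d+1},\dots,B_{v,m}]\,\zeta_u,\qquad r^{(d;m)}(a^{\widetilde{\oplus}n};B)^{-1}=\begin{bmatrix} \ast & \ast & \cdots & \ast \\ \ast & \zeta_1 & \cdots & \zeta_{m-d} \end{bmatrix},$$ for $\sigma\in\widetilde{\rho}^{(d;m)}_n(\pi;\mathcal{B})$, $a\in\pi$, $B\in\sigma$, where $\zeta_u\in M_{d,1}(M_n(\mathcal{A}))$; i.e. $\zeta_u$ consists of the last $d$ block entries of the $(d+u)$-th block column of the inverse. This is well defined and is an nc function. *)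

(* Defs.v *)
From HB Require Import structures.
From mathcomp Require Import all_boot all_algebra generic_quotient.
From mathcomp Require Import boolp classical_sets.

Set Implicit Arguments.
Unset Strict Implicit.
Unset Printing Implicit Defensive.

Import GRing.Theory.
Local Open Scope ring_scope.
Local Open Scope classical_set_scope.
Local Open Scope quotient_scope.

(* M_m(M_n(C)): block matrices are matrices with entries in the ring 'M[C]_n. *)
Notation bmx C m n := 'M['M[C]_n]_m.

Section Invertibility.
Variable S : pzRingType.

Definition is_inverse (x y : S) := x * y = 1 /\ y * x = 1.
Definition invertible (x : S) := exists y, is_inverse x y.

(* The two-sided inverse of x; its value is irrelevant if x is not invertible.
   The library inverse does not apply, as S need not be a unitRingType. *)
Definition inverse (x : S) : S := xget 0 [set y | is_inverse x y].

Lemma is_inverseM x x' y y' :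
  is_inverse x x' -> is_inverse y y' -> is_inverse (x * y) (y' * x').
Proof.
move=> [xx' x'x] [yy' y'y]; split.
  by rewrite mulrA -(mulrA x) yy' mulr1.
by rewrite mulrA -(mulrA y') x'x mulr1.
Qed.

Lemma invertible1 : invertible 1.
Proof. by exists 1; split; rewrite mulr1. Qed.

Lemma is_inverse_uniq (x y z : S) :
  is_inverse x y -> is_inverse x z -> y = z.
Proof. by move=> [_ yx] [xz _]; rewrite -[y]mulr1 -xz mulrA yx mul1r. Qed.

Lemma inverseP (x : S) :
  invertible x -> is_inverse x (inverse x).
Proof. by case=> y xy; exact: (@xgetI _ 0 [set y | is_inverse x y] y xy). Qed.

Lemma inverseE (x y : S) : is_inverse x y -> inverse x = y.
Proof. by move=> xy; apply: is_inverse_uniq (inverseP (ex_intro _ y xy)) xy. Qed.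

End Invertibility.

Section Indices.
Variables (m d : nat) (hd : (d <= m)%N).

(* In the 1-based numbering of [m]: j, d + p and m - d + j respectively. *)
Definition top_ord (j : 'I_d) : 'I_m := widen_ord hd j.
Definition bot_ord (p : 'I_(m - d)) : 'I_m := cast_ord (subnKC hd) (rshift d p).
Definition last_ord (j : 'I_d) : 'I_m := cast_ord (subnK hd) (rshift (m - d) j).

End Indices.

Section BlockMatrices.
Variables (C : pzRingType) (m : nat).

Definition bdsum n n' (P : bmx C m n) (Q : bmx C m n') : bmx C m (n + n') :=
  \matrix_(i, j) block_mx (P i j) 0 0 (Q i j).

Fixpoint bdsum_iter (P : bmx C m 1) (n : nat) : bmx C m n :=
  if n is n'.+1 then bdsum P (bdsum_iter P n') else 0.

Lemma bdsumM n n' (P P' : bmx C m n) (Q Q' : bmx C m n') :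
  bdsum P Q * bdsum P' Q' = bdsum (P * P') (Q * Q').
Proof.
apply/matrixP => i j; rewrite !mxE.
under eq_bigr => k _ do rewrite !mxE [_ * _]mulmx_block !(mulmx0, mul0mx, addr0, add0r).
elim/big_ind3: _ => [|x1 x2 ? y1 y2 ? -> ->|//]; first by rewrite [RHS]block_mx_const.
by rewrite [in LHS](add_block_mx x2) !addr0.
Qed.

Lemma bdsum1 n n' : bdsum (1 : bmx C m n) (1 : bmx C m n') = 1.
Proof.
apply/matrixP => i j; rewrite !mxE; case: (i == j); rewrite !(mulr1n, mulr0n).
  by rewrite -[LHS]scalar_mx_block.
exact: block_mx_const.
Qed.

Lemma bdsum_inverse n n' (P P' : bmx C m n) (Q Q' : bmx C m n') :
  is_inverse P P' -> is_inverse Q Q' ->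
  is_inverse (bdsum P Q) (bdsum P' Q').
Proof.
by move=> [PP' P'P] [QQ' Q'Q]; split; rewrite bdsumM ?PP' ?QQ' ?P'P ?Q'Q bdsum1.
Qed.

Lemma strict_upper_mul0 n n' (P Q : bmx C m (n + n')) (p : bmx C m n)
    (q : bmx C m n') :
  (forall i j, exists X, P i j = block_mx 0 X 0 0) ->
  (forall i j, exists X, Q i j = block_mx 0 X 0 0) ->
  P * bdsum p q * Q = 0.
Proof.
move=> sP sQ.
have sPp i j : exists X, (P * bdsum p q) i j = block_mx 0 X 0 0.
  rewrite mxE; elim/big_ind: _ => [|x y [X ->] [Y ->]|k _].
  - by exists 0; rewrite block_mx_const.
  - by exists (X + Y); rewrite [LHS]add_block_mx !addr0.
  - have [X ->] := sP i k; exists (X *m q k j).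
    by rewrite mxE [LHS]mulmx_block !(mulmx0, mul0mx, addr0, add0r).
apply/matrixP => i j; rewrite !mxE big1 // => k _.
have [X ->] := sPp i k; have [Y ->] := sQ k j.
by rewrite [LHS]mulmx_block !(mulmx0, mul0mx, addr0) block_mx_const.
Qed.

End BlockMatrices.

Lemma perturb_inverse (S : pzRingType) (x y z : S) :
  is_inverse x y -> z * y * z = 0 -> is_inverse (x + z) (y - y * z * y).
Proof.
move=> [xy yx] zyz; split.
  rewrite mulrBr !mulrDl !mulrA xy mul1r zyz mul0r addr0 -addrA.
  by rewrite subrr addr0.
by rewrite mulrBl !mulrDr -!mulrA yx mulr1 [z * (y * z)]mulrA zyz mulr0 addr0 -addrA subrr addr0.
Qed.

Section Grassmannian.
Variables (C : pzRingType) (m e : nat) (he : (e <= m)%N) (n : nat).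

Record GL := MkGL { gl_mx :> bmx C m n; _ : `[< invertible gl_mx >] }.
HB.instance Definition _ := [isSub for gl_mx].
HB.instance Definition _ := [Choice of GL by <:].

Lemma gl_mxP (P : GL) : invertible (gl_mx P).
Proof. by case: P => P /= /asboolP. Qed.

Definition mkGL (P : bmx C m n) (hP : invertible P) : GL := MkGL (asboolT hP).

Definition block_lower : set (bmx C m n) :=
  [set G | exists (X : bmx C (m - e) n) (Y : 'M['M[C]_n]_(e, m - e))
             (Z : bmx C e n),
     [/\ invertible X, invertible Z &
         G = castmx (subnK he, subnK he) (block_mx X 0 Y Z)]].

Lemma block_lower_mulE (k : nat) (E : (m - e + e = k)%N)
    (P Q : 'M['M[C]_n]_(m - e + e)) :
  castmx (E, E) (P *m Q) = castmx (E, E) P *m castmx (E, E) Q.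
Proof. by case: _ / E. Qed.

Lemma block_lower_oneE (k : nat) (E : (m - e + e = k)%N) :
  castmx (E, E) (1 : 'M['M[C]_n]_(m - e + e)) = 1.
Proof. by case: _ / E. Qed.

Lemma block_lower1 : block_lower 1.
Proof.
exists 1, 0, 1; split; try exact: invertible1.
by rewrite -[X in castmx _ X]scalar_mx_block block_lower_oneE.
Qed.

Lemma block_lowerM G G' :
  block_lower G -> block_lower G' -> block_lower (G * G').
Proof.
move=> [X [Y [Z [[Xi hX] [Zi hZ] ->]]]] [X' [Y' [Z' [[Xi' hX'] [Zi' hZ'] ->]]]].
exists (X * X'), (Y *m X' + Z *m Y'), (Z * Z'); split.
- by eexists; apply: is_inverseM; eassumption.
- by eexists; apply: is_inverseM; eassumption.
- by rewrite [LHS]/GRing.mul /= -block_lower_mulE mulmx_block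
    !(mulmx0, mul0mx, addr0, add0r).
Qed.

Lemma block_lowerV G :
  block_lower G -> exists2 G', block_lower G' & is_inverse G G'.
Proof.
move=> [X [Y [Z [[Xi [XXi XiX]] [Zi [ZZi ZiZ]] ->]]]].
exists (castmx (subnK he, subnK he) (block_mx Xi 0 (- (Zi *m Y *m Xi)) Zi)).
  by exists Xi, (- (Zi *m Y *m Xi)), Zi; split=> //; [exists X|exists Z].
split; rewrite [LHS]/GRing.mul /= -block_lower_mulE mulmx_block
    !(mulmx0, mul0mx, addr0, add0r).
  rewrite mulmxN !mulmxA [X in X - _]/= -[Z *m Zi]/(Z * Zi) -[X *m Xi]/(X * Xi).
  by rewrite XXi ZZi mul1mx subrr -scalar_mx_block block_lower_oneE.
rewrite mulNmx -!mulmxA -[Xi *m X]/(Xi * X) -[Zi *m Z]/(Zi * Z).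
by rewrite XiX ZiZ mulmx1 addNr -scalar_mx_block block_lower_oneE.
Qed.

Definition gr_rel : rel GL :=
  fun P Q => `[< exists2 G, block_lower G & gl_mx P = gl_mx Q * G >].

Lemma gr_rel_refl : reflexive gr_rel.
Proof.
by move=> P; apply/asboolP; exists 1; rewrite ?mulr1 //; apply: block_lower1.
Qed.

Lemma gr_rel_sym : symmetric gr_rel.
Proof.
suff sub P Q : gr_rel P Q -> gr_rel Q P by move=> P Q; apply/idP/idP; apply: sub.
move=> /asboolP[G hG PE]; have [G' hG' [GG' _]] := block_lowerV hG.
by apply/asboolP; exists G' => //; rewrite PE -mulrA GG' mulr1.
Qed.

Lemma gr_rel_trans : transitive gr_rel.
Proof.
move=> Q P T /asboolP[G hG PE] /asboolP[G' hG' QE].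
by apply/asboolP; exists (G' * G); [exact: block_lowerM | rewrite PE QE mulrA].
Qed.

Canonical gr_equiv := EquivRel gr_rel gr_rel_refl gr_rel_sym gr_rel_trans.

Definition Gr := {eq_quot gr_equiv}.
HB.instance Definition _ := Choice.on Gr.
HB.instance Definition _ := EqQuotient.on Gr.

Definition gr_class (P : GL) : Gr := \pi P.

End Grassmannian.
Arguments Gr C [m e] he n.
Arguments gr_class [C m e] he [n] P.

Section GrassmannianOperations.
Variables (C : pzRingType) (m e : nat) (he : (e <= m)%N).

Lemma bdsum_GL n n' (P : GL C m n) (Q : GL C m n') :
  invertible (bdsum (gl_mx P) (gl_mx Q)).
Proof.
have [P' hP] := gl_mxP P; have [Q' hQ] := gl_mxP Q.
by exists (bdsum P' Q'); apply: bdsum_inverse.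
Qed.

Definition gr_dsum n n' (sigma : Gr C he n) (sigma' : Gr C he n') :
    Gr C he (n + n') :=
  gr_class he (mkGL (bdsum_GL (repr sigma) (repr sigma'))).

Fixpoint gr_iter (sigma : Gr C he 1) (n : nat) : Gr C he n :=
  if n is n'.+1 then gr_dsum sigma (gr_iter sigma n')
  else gr_class he (mkGL (@invertible1 (bmx C m 0))).

Section Extension.
Variables (p : 'I_(m - e)) (q : 'I_e) (n n' : nat).

Definition ext_mx (P : bmx C m n) (P' : bmx C m n') (X : 'M[C]_(n, n')) :
    bmx C m (n + n') :=
  bdsum P P' +
  \sum_(j < e)
    block_mx 0 (X *m P' (top_ord he q) (last_ord he j)) 0 0
      *: delta_mx (bot_ord he p) (last_ord he j).

Lemma ext_mx_GL (P : GL C m n) (P' : GL C m n') (X : 'M[C]_(n, n')) :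
  invertible (ext_mx (gl_mx P) (gl_mx P') X).
Proof.
have [Q hQ] := gl_mxP P; have [Q' hQ'] := gl_mxP P'.
eexists; apply: perturb_inverse; first exact: bdsum_inverse hQ hQ'.
set N := \sum_(j < e) _.
suff sN i j : exists Y, N i j = block_mx 0 Y 0 0 by apply: strict_upper_mul0.
rewrite summxE; elim/big_ind: _ => [|x y [Y ->] [Z ->]|k _].
- by exists 0; rewrite block_mx_const.
- by exists (Y + Z); rewrite [LHS]add_block_mx !addr0.
rewrite !mxE; case: (_ && _); first by eexists; rewrite mulr1.
by exists 0; rewrite mulr0 block_mx_const.
Qed.

Definition gr_ext (sigma : Gr C he n) (sigma' : Gr C he n')
    (X : 'M[C]_(n, n')) : Gr C he (n + n') :=
  gr_class he (mkGL (ext_mx_GL (repr sigma) (repr sigma') X)).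

End Extension.
End GrassmannianOperations.

Section NcFunctions.
Variables (R : comNzRingType) (B : algType R) (m d : nat) (hd : (d <= m)%N).

Definition scale_mx (V : lmodType R) n n' (r : R) (X : 'M[V]_(n, n')) :
    'M[V]_(n, n') := map_mx ( *:%R r) X.

(* A graded subset of the Grassmannian; only the levels n >= 1 matter. *)
Definition grset := forall n, set (Gr B hd n).

Definition is_ncset (Omega : grset) :=
  forall n n' (sigma : Gr B hd n) (sigma' : Gr B hd n'),
    (0 < n)%N -> (0 < n')%N -> Omega n sigma -> Omega n' sigma' ->
    Omega (n + n')%N (gr_dsum sigma sigma').

Definition admissible (Omega : grset) (p : 'I_(m - d)) (q : 'I_d) :=
  forall n n' (sigma : Gr B hd n) (sigma' : Gr B hd n') (X : 'M[B]_(n, n')),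
    (0 < n)%N -> (0 < n')%N -> Omega n sigma -> Omega n' sigma' ->
    exists2 r : R, invertible r &
      Omega (n + n')%N (gr_ext p q sigma sigma' (scale_mx r X)).

(* Off Omega the values of such a function are irrelevant. *)
Definition grfun (N : lmodType R) := forall n, Gr B hd n -> 'M[N]_n.

(* The matrix r^-1 H, where f takes the block upper triangular value with
   corner H at the (p, q)-extension by r X. *)
Definition ddiff (N : lmodType R) (Omega : grset) (p : 'I_(m - d)) (q : 'I_d)
    (f : grfun N) n n' (sigma : Gr B hd n) (sigma' : Gr B hd n')
    (X : 'M[B]_(n, n')) : 'M[N]_(n, n') :=
  xget 0 [set D | exists (r : R) (H : 'M[N]_(n, n')),
    let tau := gr_ext p q sigma sigma' (scale_mx r X) in
    [/\ invertible r, Omega (n + n')%N tau,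
        f (n + n')%N tau = block_mx (f n sigma) H 0 (f n' sigma') &
        D = scale_mx (inverse r) H]].

End NcFunctions.

Section Resolvent.
Variables (R : comNzRingType) (A : algType R) (S : {pred A}) (B : subAlgType S).
Variables (m d : nat) (hd : (d <= m)%N).

Definition incl_mx n n' (X : 'M[B]_(n, n')) : 'M[A]_(n, n') := map_mx \val X.
Definition incl_bmx n (Q : bmx B m n) : bmx A m n := map_mx (@incl_mx n n) Q.

Definition res_mx n (P Q : bmx A m n) : bmx A m n :=
  castmx (erefl m, subnK hd)
    (row_mx (colsub (bot_ord hd) P) (colsub (last_ord hd) Q)).

Variable pi : Gr A (leq_subr d m) 1.

Definition resolvent_set : grset B hd :=
  fun n => [set sigma | exists (P : GL A m n) (Q : GL B m n),
    [/\ gr_class (leq_subr d m) P = gr_iter pi n, gr_class hd Q = sigma &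
        invertible (res_mx (gl_mx P) (incl_bmx (gl_mx Q)))]].

Definition resolvent (v : 'I_d) (u : 'I_(m - d)) : grfun B hd A :=
  fun n sigma =>
    let a : bmx A m 1 := gl_mx (repr pi) in
    let Q := incl_bmx (gl_mx (repr sigma)) in
    let T := inverse (res_mx (bdsum_iter a n) Q) in
    \sum_(j < d) Q (top_ord hd v) (last_ord hd j)
                   *m T (last_ord hd j) (bot_ord hd u).

End Resolvent.
Arguments resolvent_set {R A S} B {m d} hd pi n _.
Arguments resolvent {R A S} B {m d} hd pi v u [n] sigma.

(* The operations above are computed on chosen representatives; the results
   below show that they do not depend on this choice. *)

Section Indep.
Variables (C : pzRingType) (m e : nat) (he : (e <= m)%N).

Lemma gr_classP n (P Q : GL C m n) :
  gr_class he P = gr_class he Q <->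
  exists2 G, block_lower he G & gl_mx P = gl_mx Q * G.
Proof.
split=> [/eqmodP/asboolP //|h]; apply/eqmodP; exact/asboolP.
Qed.

Lemma gr_class_repr n (sigma : Gr C he n) : gr_class he (repr sigma) = sigma.
Proof. exact: reprK. Qed.

Lemma block_lower_bdsum n n' (G : bmx C m n) (G' : bmx C m n') :
  block_lower he G -> block_lower he G' -> block_lower he (bdsum G G').
Proof.
move=> [X [Y [Z [[Xi hX] [Zi hZ] ->]]]] [X' [Y' [Z' [[Xi' hX'] [Zi' hZ'] ->]]]].
exists (bdsum X X'), (\matrix_(i, j) block_mx (Y i j) 0 0 (Y' i j)), (bdsum Z Z').
split.
- by eexists; apply: bdsum_inverse; eassumption.
- by eexists; apply: bdsum_inverse; eassumption.
apply/matrixP => i j; rewrite mxE !castmxE; move: (cast_ord _ i) (cast_ord _ j) => {}i {}j.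
rewrite !mxE.
by case: (split i) => k; rewrite !mxE; case: (split j) => l; rewrite !mxE ?block_mx_const.
Qed.

Lemma gr_dsum_class n n' (P : GL C m n) (P' : GL C m n') :
  gr_dsum (gr_class he P) (gr_class he P') =
  gr_class he (mkGL (bdsum_GL P P')).
Proof.
apply/gr_classP => /=.
have /gr_classP[G hG ->] := gr_class_repr (gr_class he P).
have /gr_classP[G' hG' ->] := gr_class_repr (gr_class he P').
by exists (bdsum G G'); [exact: block_lower_bdsum | rewrite bdsumM].
Qed.

Lemma colsub_last n (P G : bmx C m n) : block_lower he G ->
  exists2 Z : bmx C e n, invertible Z &
   colsub (last_ord he) (P * G) = colsub (last_ord he) P *m Z.
Proof.
move=> [X [Y [Z [_ hZ ->]]]]; exists Z => //.
apply/matrixP => i j; rewrite !mxE.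
rewrite (reindex (cast_ord (subnK he))) /=; last first.
  by apply: onW_bij; exists (cast_ord (esym (subnK he))) => k;
    rewrite ?cast_ordK ?cast_ordKV.
rewrite big_split_ord /= big1 ?add0r => [|k _].
  apply: eq_bigr => k _; rewrite !mxE castmxE /= !cast_ordK.
  by rewrite block_mxEdr.
by rewrite castmxE /= !cast_ordK block_mxEur mxE mulr0.
Qed.

Lemma castmx_sqD n (k : nat) (E : (m - e + e = k)%N)
    (P Q : 'M['M[C]_n]_(m - e + e)) :
  castmx (E, E) (P + Q) = castmx (E, E) P + castmx (E, E) Q.
Proof. by case: _ / E. Qed.

Lemma block_lower_1D n n' (F : bmx C m (n + n')) :
  (forall i j, exists X, F i j = block_mx 0 X 0 0) ->
  (forall i j, F i (last_ord he j) = 0) -> block_lower he (1 + F).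
Proof.
move=> sF F0.
pose F' := castmx (esym (subnK he), esym (subnK he)) F.
have FE : F = castmx (subnK he, subnK he) F' by rewrite castmxKV.
have eF0 : ursubmx F' = 0.
  apply/matrixP => i j; rewrite !mxE castmxE -[RHS](F0 (cast_ord (subnK he) (lshift e i)) j).
  by congr (F _ _); apply: val_inj.
have eF1 : drsubmx F' = 0.
  apply/matrixP => i j; rewrite !mxE castmxE -[RHS](F0 (cast_ord (subnK he) (rshift (m - e) i)) j).
  by congr (F _ _); apply: val_inj.
pose X1 : bmx C (m - e) (n + n') := ulsubmx F'.
have XX : X1 * X1 = 0.
  rewrite -[X in X * _]mulr1 -(@bdsum1 C (m - e) n n'); apply: (@strict_upper_mul0 _ _ n n' X1 X1 1 1) => i j;
  by rewrite !mxE castmxE.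
exists (1 + X1), (dlsubmx F'), 1; split.
- exists (1 - X1); split; rewrite mulrDl !mulrDr ?mulrN ?mulNr !mulr1 ?mul1r XX oppr0 addr0.
    by rewrite subrK.
  by rewrite addrK.
- exact: invertible1.
rewrite -[1 in LHS](block_lower_oneE _ _ (subnK he)) FE -[F']submxK eF0 eF1.
rewrite [X in castmx _ X + _]scalar_mx_block.
refine (etrans (esym (castmx_sqD _ _ _)) _); congr castmx.
rewrite [LHS]add_block_mx; congr block_mx; rewrite ?addr0 ?add0r ?block_mxKdl //.
Qed.

Lemma ext_mx_lower (p : 'I_(m - e)) (q : 'I_e) n n' (P : bmx C m n) (P' : bmx C m n')
    (X : 'M[C]_(n, n')) : invertible P -> invertible P' ->
  exists2 G, block_lower he G &
    (1 + block_mx 0 X 0 0 *: delta_mx (bot_ord he p) (top_ord he q)) * bdsum P P'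
     = ext_mx he p q P P' X * G.
Proof.
move=> [Q hQ] [Q' hQ'].
set E := _ *: _; pose D := ext_mx he p q P P' X.
have sD i j : exists Y, (D - bdsum P P') i j = block_mx 0 Y 0 0.
  rewrite /D /ext_mx addrAC subrr add0r.
  rewrite summxE; elim/big_ind: _ => [|x y [Y ->] [Z ->]|k _].
  - by exists 0; rewrite block_mx_const.
  - by exists (Y + Z); rewrite [LHS]add_block_mx !addr0.
  rewrite !mxE; case: (_ && _); first by eexists; rewrite mulr1.
  by exists 0; rewrite mulr0 block_mx_const.
have EE i j : (E * bdsum P P') i j =
    if i == bot_ord he p then block_mx 0 (X *m P' (top_ord he q) j) 0 0 else 0.
  rewrite mxE (bigD1 (top_ord he q)) //= big1 ?addr0 => [|k kq].
    rewrite !mxE eqxx andbT; case: (_ == _); last by rewrite mulr0 mul0r.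
    by rewrite mulr1 [LHS]mulmx_block !(mulmx0, mul0mx, addr0, add0r).
  by rewrite !mxE (negbTE kq) andbF mulr0 mul0r.
pose F := E * bdsum P P' - (D - bdsum P P').
have FE i j : F i j = (E * bdsum P P') i j - (D - bdsum P P') i j.
  by rewrite /F mxE [X in _ + X]mxE.
have sF i j : exists Y, F i j = block_mx 0 Y 0 0.
  rewrite FE EE; have [Y ->] := sD i j.
  case: ifP => _; rewrite opp_block_mx ?add0r !oppr0.
    by eexists; rewrite [LHS]add_block_mx !addr0.
  by eexists.

have F0 i j : F i (last_ord he j) = 0.
  rewrite FE EE.
  rewrite /D /ext_mx addrAC subrr add0r summxE (bigD1 j) //= big1 ?addr0 => [|k kj].
    rewrite !mxE eqxx andbT; case: (_ == _); first by rewrite mulr1 subrr.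
    by rewrite mulr0 subrr.
  rewrite !mxE; case: eqP => _ /=; last by rewrite mulr0.
  case: eqP => [|_]; last by rewrite mulr0.
  by move=> /cast_ord_inj/rshift_inj jk; rewrite jk eqxx in kj.
pose W := bdsum Q Q'.
have [bW Wb] : is_inverse (bdsum P P') W by apply: bdsum_inverse.
have sWF i j : exists Y, (W * F) i j = block_mx 0 Y 0 0.
  rewrite mxE; elim/big_ind: _ => [|x y [Y ->] [Z ->]|k _].
  - by exists 0; rewrite block_mx_const.
  - by exists (Y + Z); rewrite [LHS]add_block_mx !addr0.
  have [Y ->] := sF k j; eexists.
  by rewrite mxE [LHS]mulmx_block !(mulmx0, mul0mx, addr0, add0r).
exists (1 + W * F).
  apply: block_lower_1D => // i j; rewrite mxE big1 // => k _.
  by rewrite F0 mulr0.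
have DWF : D * (W * F) = F.
  have -> : D = bdsum P P' + (D - bdsum P P') by rewrite addrC subrK.
  rewrite mulrA [_ * W]mulrDl bW [LHS]mulrDl mul1r.
  by rewrite (strict_upper_mul0 _ _ sD sF) addr0.
rewrite -/D mulrDr mulr1 DWF /F mulrDl mul1r opprB.
by rewrite [RHS]addrC -!addrA addNr addr0 addrC.
Qed.

Lemma gr_ext_class (p : 'I_(m - e)) (q : 'I_e) n n' (P : GL C m n) (P' : GL C m n')
    (X : 'M[C]_(n, n')) :
  gr_ext p q (gr_class he P) (gr_class he P') X =
  gr_class he (mkGL (ext_mx_GL he p q P P' X)).
Proof.
apply/gr_classP => /=.
set P0 := repr _; set P0' := repr _.
have /gr_classP[G hG PG] := gr_class_repr (gr_class he P).
have /gr_classP[G' hG' PG'] := gr_class_repr (gr_class he P').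
have [G1 hG1 E1] := ext_mx_lower p q X (gl_mxP P0) (gl_mxP P0').
have [G2 hG2 E2] := ext_mx_lower p q X (gl_mxP P) (gl_mxP P').
have [G1' hG1' [GG _]] := block_lowerV hG1.
exists (G2 * bdsum G G' * G1').
  by apply: block_lowerM => //; apply: block_lowerM => //; apply: block_lower_bdsum.
rewrite -[LHS]mulr1 -GG [LHS]mulrA -E1 2!mulrA -E2.
by rewrite PG PG' -bdsumM !mulrA.
Qed.

End Indep.

Section Iter.
Variables (C : pzRingType) (m e : nat) (he : (e <= m)%N).

Lemma bdsum_iter_GL n (P : GL C m 1) : invertible (bdsum_iter (gl_mx P) n).
Proof.
elim: n => [|n [Q' hQ']] /=.
  suff -> : (0 : bmx C m 0) = 1 by exact: invertible1.
  by apply/matrixP => i j; apply/matrixP; case.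
have [Q hQ] := gl_mxP P.
exists (bdsum Q Q' : bmx C m (1 + n)); exact: (@bdsum_inverse C m 1 n _ _ _ _ hQ hQ').
Qed.

Lemma gr_iter_class n (P : GL C m 1) :
  gr_iter (gr_class he P) n = gr_class he (mkGL (bdsum_iter_GL n P)).
Proof.
elim: n => [|n IH] /=.
  congr gr_class; apply: val_inj; apply/matrixP => i j; apply/matrixP; case=> //.
rewrite IH gr_dsum_class; congr gr_class; exact: val_inj.
Qed.

Lemma bdsum_iterE n (P : bmx C m 1) i j : bdsum_iter P n i j = (P i j 0 0)%:M.
Proof.
elim: n => [|n IH] /=; first by apply/matrixP; case.
rewrite mxE IH {1}[P i j]mx11_scalar; exact: esym (@scalar_mx_block _ 1 n _).
Qed.

Lemma bdsum_iterD n n' (P : bmx C m 1) :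
  bdsum_iter P (n + n') = bdsum (bdsum_iter P n) (bdsum_iter P n').
Proof. by apply/matrixP => i j; rewrite mxE !bdsum_iterE scalar_mx_block. Qed.

End Iter.

Section ResolventIndep.
Variables (R : comNzRingType) (A : algType R) (S : {pred A}) (B : subAlgType S).
Variables (m d : nat) (hd : (d <= m)%N).

Lemma last_ord_subr j : last_ord (leq_subr d m) j = bot_ord hd j.
Proof. by apply: val_inj; rewrite /= subKn. Qed.

Lemma incl_bmxM k n (P Q : bmx B k n) : incl_bmx (P * Q) = incl_bmx P * incl_bmx Q.
Proof.
apply/matrixP => i j; rewrite !mxE.
rewrite (big_morph (@incl_mx _ _ _ _ n n) (id1 := 0) (op1 := +%R)) /=.
- by apply: eq_bigr => l _; rewrite !mxE; exact: map_mxM.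
- by move=> x y; exact: map_mxD.
- exact: map_mx0.
Qed.

Lemma incl_bmx_inverse k n (X Y : bmx B k n) :
  is_inverse X Y -> is_inverse (incl_bmx X) (incl_bmx Y).
Proof.
have I1 : incl_bmx (1 : bmx B k n) = 1 :> bmx A k n.
  apply/matrixP => i j; rewrite !mxE; case: (i == j).
    by rewrite !mulr1n; exact: map_mx1.
  by rewrite !mulr0n; exact: map_mx0.
by move=> [XY YX]; split; rewrite -incl_bmxM ?XY ?YX.
Qed.

Lemma incl_bmx_lower n (G : bmx B m n) :
  block_lower hd G -> block_lower hd (incl_bmx G).
Proof.
move=> [X [Y [Z [[Xi hX] [Zi hZ] ->]]]].
exists (incl_bmx X), (map_mx (@incl_mx _ _ _ _ n n) Y), (incl_bmx Z); split.
- by eexists; apply: incl_bmx_inverse hX.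
- by eexists; apply: incl_bmx_inverse hZ.
by rewrite /incl_bmx map_castmx map_block_mx; congr (castmx _ (block_mx _ _ _ _));
  apply/matrixP => i j; rewrite !mxE; exact: map_mx0.
Qed.

Lemma rowsub_last (C : pzRingType) n (Z1 : bmx C (m - d) n) (Z2 : bmx C d n) (T : bmx C m n) :
  rowsub (last_ord hd)
    ((castmx (subnK hd, subnK hd) (block_mx Z1 0 0 Z2) : bmx C m n) * T)
  = Z2 *m rowsub (last_ord hd) T.
Proof.
apply/matrixP => i j; rewrite !mxE.
rewrite (reindex (cast_ord (subnK hd))) /=; last first.
  by apply: onW_bij; exists (cast_ord (esym (subnK hd))) => k;
    rewrite ?cast_ordK ?cast_ordKV.
rewrite big_split_ord /= big1 ?add0r => [|k _].
  apply: eq_bigr => k _; rewrite !mxE castmxE /= !cast_ordK.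
  by rewrite block_mxEdr.
by rewrite castmxE /= !cast_ordK block_mxEdl mxE mul0r.
Qed.

Lemma castmx_row_block (C : pzRingType) n k (E : (m - d + d = k)%N)
    (U : 'M['M[C]_n]_(m, m - d)) (V : 'M['M[C]_n]_(m, d))
    (Z1 : bmx C (m - d) n) (Z2 : bmx C d n) :
  castmx (erefl m, E) (row_mx (U *m Z1) (V *m Z2)) =
  castmx (erefl m, E) (row_mx U V) *m castmx (E, E) (block_mx Z1 0 0 Z2).
Proof. by case: _ / E; rewrite !castmx_id mul_row_block !mulmx0 addr0 add0r. Qed.

Lemma block_diag_inverse (C : pzRingType) n (Z1 Z1' : bmx C (m - d) n)
    (Z2 Z2' : bmx C d n) :
  is_inverse Z1 Z1' -> is_inverse Z2 Z2' ->
  is_inverse (castmx (subnK hd, subnK hd) (block_mx Z1 0 0 Z2) : bmx C m n)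
    (castmx (subnK hd, subnK hd) (block_mx Z1' 0 0 Z2')).
Proof.
move=> [e1 e1'] [e2 e2']; split; rewrite [LHS]/GRing.mul /= -block_lower_mulE mulmx_block
   !(mulmx0, mul0mx, addr0, add0r).
  rewrite -[Z1 *m _]/(Z1 * Z1') -[Z2 *m _]/(Z2 * Z2') e1 e2.
  by rewrite -scalar_mx_block block_lower_oneE.
rewrite -[Z1' *m _]/(Z1' * Z1) -[Z2' *m _]/(Z2' * Z2) e1' e2'.
by rewrite -scalar_mx_block block_lower_oneE.
Qed.

Lemma res_mxM n (P Q G G' : bmx A m n) :
  block_lower (leq_subr d m) G -> block_lower hd G' ->
  exists Z Z' : bmx A m n,
  [/\ is_inverse Z Z', res_mx hd (P * G) (Q * G') = res_mx hd P Q * Z &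
   forall T : bmx A m n,
   colsub (last_ord hd) (Q * G') *m rowsub (last_ord hd) (Z' * T)
   = colsub (last_ord hd) Q *m rowsub (last_ord hd) T].
Proof.
move=> /(colsub_last P)[Z1 [Z1' h1] e1] /(colsub_last Q)[Z2 [Z2' h2] e2].
have bE (U : bmx A m n) : colsub (bot_ord hd) U = colsub (last_ord (leq_subr d m)) U.
  by apply/matrixP => i j; rewrite !mxE last_ord_subr.
exists (castmx (subnK hd, subnK hd) (block_mx Z1 0 0 Z2)).
exists (castmx (subnK hd, subnK hd) (block_mx Z1' 0 0 Z2')); split.
- exact: block_diag_inverse.
- by rewrite /res_mx !bE e1 e2 castmx_row_block.
move=> T; rewrite rowsub_last e2 mulmxA -(mulmxA _ Z2).
case: h2 => h2 _; rewrite -[Z2 *m _]/(Z2 * Z2') h2; congr (_ *m _); exact: mulmx1.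
Qed.

Variable pi : Gr A (leq_subr d m) 1.
Implicit Types (a : GL A m 1).

Lemma resolvent_aux n a a' (Q Q' : GL B m n) :
  gr_class (leq_subr d m) a = gr_class (leq_subr d m) a' -> gr_class hd Q = gr_class hd Q' ->
  invertible (res_mx hd (bdsum_iter (gl_mx a) n) (incl_bmx (gl_mx Q))) ->
  invertible (res_mx hd (bdsum_iter (gl_mx a') n) (incl_bmx (gl_mx Q'))) /\
  (colsub (last_ord hd) (incl_bmx (gl_mx Q')) *m rowsub (last_ord hd)
     (inverse (res_mx hd (bdsum_iter (gl_mx a') n) (incl_bmx (gl_mx Q')))) =
  colsub (last_ord hd) (incl_bmx (gl_mx Q)) *m rowsub (last_ord hd)
     (inverse (res_mx hd (bdsum_iter (gl_mx a) n) (incl_bmx (gl_mx Q))))).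
Proof.
move=> aE QE inv.
have : gr_class (leq_subr d m) (mkGL (bdsum_iter_GL n a')) = gr_class (leq_subr d m) (mkGL (bdsum_iter_GL n a)).
  by rewrite -!gr_iter_class -aE.
move=> /gr_classP[G hG /= ->]; have /esym/gr_classP[G' /incl_bmx_lower hG' ->] := QE.
rewrite incl_bmxM.
have [Z [Z' [hZ -> h]]] := res_mxM (bdsum_iter (gl_mx a) n) (incl_bmx (gl_mx Q)) hG hG'.
have hT := inverseP inv; have hTZ := is_inverseM hT hZ.
by split; [eexists; exact: hTZ | rewrite (inverseE hTZ) h].
Qed.

Lemma resolvent_entry n a (Q : GL B m n) v u :
  \sum_(j < d) incl_bmx (gl_mx Q) (top_ord hd v) (last_ord hd j)
      *m inverse (res_mx hd (bdsum_iter (gl_mx a) n) (incl_bmx (gl_mx Q)))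
           (last_ord hd j) (bot_ord hd u) =
  (colsub (last_ord hd) (incl_bmx (gl_mx Q)) *m rowsub (last_ord hd)
     (inverse (res_mx hd (bdsum_iter (gl_mx a) n) (incl_bmx (gl_mx Q)))))
     (top_ord hd v) (bot_ord hd u).
Proof. by rewrite [RHS]mxE; apply: eq_bigr => j _; rewrite !mxE. Qed.

Lemma resolvent_setP n a (Q : GL B m n) :
  gr_class (leq_subr d m) a = pi ->
  resolvent_set B hd pi n (gr_class hd Q) <->
  invertible (res_mx hd (bdsum_iter (gl_mx a) n) (incl_bmx (gl_mx Q))).
Proof.
move=> <-; split; last first.
  move=> h; exists (mkGL (bdsum_iter_GL n a)), Q; split => //.
  by rewrite gr_iter_class.
move=> [P [Q' [PE QE]]].
have /gr_classP[G hG /= ->] : gr_class (leq_subr d m) P = gr_class (leq_subr d m) (mkGL (bdsum_iter_GL n a)).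
  by rewrite -gr_iter_class.
have /gr_classP[G' /incl_bmx_lower hG' ->] := QE.
rewrite incl_bmxM.
have [Z [Z' [[Z1 Z2] -> _]]] := res_mxM (bdsum_iter (gl_mx a) n) (incl_bmx (gl_mx Q)) hG hG'.
move=> [T hT]; have := is_inverseM hT (conj Z2 Z1).
by rewrite -mulrA Z1 mulr1 => h; eexists; exact: h.
Qed.

Lemma resolvent_class n a (Q : GL B m n) v u :
  gr_class (leq_subr d m) a = pi ->
  resolvent_set B hd pi n (gr_class hd Q) ->
  resolvent B hd pi v u (gr_class hd Q) =
  \sum_(j < d) incl_bmx (gl_mx Q) (top_ord hd v) (last_ord hd j)
      *m inverse (res_mx hd (bdsum_iter (gl_mx a) n) (incl_bmx (gl_mx Q)))
           (last_ord hd j) (bot_ord hd u).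
Proof.
move=> aE /(resolvent_setP _ aE) h; rewrite /resolvent !resolvent_entry.
have e1 : gr_class (leq_subr d m) a = gr_class (leq_subr d m) (repr pi) by rewrite gr_class_repr.
have e2 := esym (gr_class_repr (gr_class hd Q)).
by have [_ ->] := resolvent_aux e1 e2 h.
Qed.

Lemma bdsum_incl n n' (Q : bmx B m n) (Q' : bmx B m n') :
  incl_bmx (bdsum Q Q') = bdsum (incl_bmx Q) (incl_bmx Q').
Proof.
apply/matrixP => i j; rewrite !mxE; apply: etrans (map_block_mx _ _ _ _ _) _.
by rewrite !map_mx0.
Qed.

Lemma res_mx_bdsum n n' (P Q : bmx A m n) (P' Q' : bmx A m n') :
  res_mx hd (bdsum P P') (bdsum Q Q') = bdsum (res_mx hd P Q) (res_mx hd P' Q').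
Proof.
apply/matrixP => i j; rewrite [RHS]mxE !castmxE; move: (cast_ord _ i) (cast_ord _ j) => {}i {}j.
by rewrite !mxE; case: (split j) => k; rewrite !mxE.
Qed.

Lemma resolvent_set_ncset : is_ncset (resolvent_set B hd pi).
Proof.
move=> n n' sigma sigma' _ _; rewrite -[sigma]gr_class_repr -[sigma']gr_class_repr.
rewrite gr_dsum_class.
move=> /(resolvent_setP _ (gr_class_repr pi))[T hT] /(resolvent_setP _ (gr_class_repr pi))[T' hT'].
apply/(resolvent_setP _ (gr_class_repr pi)) => /=.
rewrite bdsum_incl bdsum_iterD res_mx_bdsum.
by exists (bdsum T T'); exact: bdsum_inverse.
Qed.

End ResolventIndep.

(* Main.v *)
(** Passing from the direct sum of sigma and sigma' to the extension by X adds
    to the matrix r(a; B) a term N which is strictly upper triangular in the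
    n + n' splitting, so with W the direct sum of the two inverses N W N = 0
    and the new inverse is W - W N W.  The only nonzero block row of N is row
    d + s, whose last d entries have corners X B'_(t, m-d+j).  Hence the corners
    of W N W in block column d + u form column d + s of the first inverse times X
    times the (t, u) resolvent at sigma'.  As row v <= d of N vanishes, multiplying
    by row v of the extended B gives the formula. *)
Require Import Defs.
From mathcomp Require Import all_boot all_algebra.
From mathcomp Require Import classical_sets.
Import GRing.Theory.
Local Open Scope ring_scope.

Lemma mul_delta_entry (S : pzRingType) (m : nat) (W V : 'M[S]_m) (c : S)
    (a b i k : 'I_m) :
  (W * (c *: delta_mx a b) * V) i k = W i a * c * V b k.
Proof.
rewrite mxE (bigD1 b) //= big1 ?addr0 => [|l lb].
  rewrite mxE (bigD1 a) //= big1 ?addr0 => [|l la].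
    by rewrite !mxE !eqxx mulr1.
  by rewrite !mxE (negbTE la) mulr0 mulr0.
rewrite mxE big1 ?mul0r // => x _.
by rewrite !mxE (negbTE lb) andbF mulr0 mulr0.
Qed.

Lemma sum_block_mx (V : nmodType) (I : Type) (r : seq I) m1 m2 n1 n2
    (F11 : I -> 'M[V]_(m1, n1)) (F12 : I -> 'M[V]_(m1, n2))
    (F21 : I -> 'M[V]_(m2, n1)) (F22 : I -> 'M[V]_(m2, n2)) :
  \sum_(i <- r) block_mx (F11 i) (F12 i) (F21 i) (F22 i) =
  block_mx (\sum_(i <- r) F11 i) (\sum_(i <- r) F12 i)
    (\sum_(i <- r) F21 i) (\sum_(i <- r) F22 i).
Proof.
elim: r => [|i r IH]; first by rewrite !big_nil block_mx_const.
by rewrite !big_cons IH add_block_mx.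
Qed.

Section ExtensionTerm.
Variables (C : pzRingType) (m d : nat) (hd : (d <= m)%N).
Variables (p : 'I_(m - d)) (q : 'I_d) (n n' : nat).
Variables (P' : bmx C m n') (X : 'M[C]_(n, n')).

(** The term that [ext_mx] adds to [bdsum P P'], named over any ring so that it can also be formed
    from images in [A]. *)
Definition ext_term : bmx C m (n + n') :=
  \sum_(j < d) block_mx 0 (X *m P' (top_ord hd q) (last_ord hd j)) 0 0
      *: delta_mx (bot_ord hd p) (last_ord hd j).

Lemma ext_term_strict i j : exists Y, ext_term i j = block_mx 0 Y 0 0.
Proof.
rewrite summxE; elim/big_ind: _ => [|x y [Y ->] [Z ->]|k _].
- by exists 0; rewrite block_mx_const.
- by exists (Y + Z); rewrite [LHS]add_block_mx !addr0.
rewrite !mxE; case: (_ && _); first by eexists; rewrite mulr1.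
by exists 0; rewrite mulr0 block_mx_const.
Qed.

Lemma ext_term_top v j : ext_term (top_ord hd v) j = 0.
Proof.
rewrite summxE big1 // => k _; rewrite !mxE.
case: eqP => [/(congr1 val) /= e|_]; last by rewrite mulr0.
by have := ltn_ord v; rewrite e ltnNge leq_addr.
Qed.

Lemma ext_term_first i (j : 'I_(m - d)) :
  ext_term i (cast_ord (subnK hd) (lshift d j)) = 0.
Proof.
rewrite summxE big1 // => k _; rewrite !mxE.
case: (_ == last_ord _ _) / eqP => [/(congr1 val) /= e|_]; last by rewrite andbF mulr0.
by have := ltn_ord j; rewrite e ltnNge leq_addr.
Qed.

(** A strictly upper corner meets only [W] on its left and [W'] on its right. All summands sit in
    block row [bot_ord hd p], so one entry of [W] factors out of the sum. *)
Lemma ext_term_conj (W : bmx C m n) (W' : bmx C m n') i k :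
  (bdsum W W' * ext_term * bdsum W W') i k =
  block_mx 0 (W i (bot_ord hd p) *m X *m
    \sum_(j < d) P' (top_ord hd q) (last_ord hd j) *m W' (last_ord hd j) k) 0 0.
Proof.
rewrite mulr_sumr mulr_suml summxE mulmx_sumr.
rewrite (big_morph (fun Y => block_mx 0 Y 0 0 : 'M[C]_(n + n')) (id1 := 0) (op1 := +%R)).
- apply: eq_bigr => j _; rewrite mul_delta_entry !mxE.
  rewrite [X in X * _]mulmx_block !(mulmx0, mul0mx, addr0, add0r).
  by rewrite [LHS]mulmx_block !(mulmx0, mul0mx, addr0, add0r) !mulmxA.
- by move=> Y Z; rewrite [RHS]add_block_mx !addr0.
- exact: block_mx_const.
Qed.

End ExtensionTerm.
Arguments ext_term {C m d} hd p q {n n'} P' X.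

(** [res_mx] keeps the last [d] block columns of its second argument in place, so a term supported
    on them passes through unchanged. *)
Lemma res_mx_addr (R : comNzRingType) (A : algType R) (m d : nat)
    (hd : (d <= m)%N) (n : nat) (P Q N : bmx A m n) :
  (forall i j, N i (cast_ord (subnK hd) (lshift d j)) = 0) ->
  res_mx hd P (Q + N) = res_mx hd P Q + N.
Proof.
move=> N0; apply/matrixP => i j; rewrite [RHS]mxE !castmxE cast_ord_id.
(* Only the column index of [N] is rewritten, so that all terms depend on one index of the splitting
   [m - d + d]. *)
rewrite -{3}(cast_ordKV (subnK hd) j); move: (cast_ord (esym _) j) => {}j.
by rewrite !mxE; case: (split_ordP j) => k ->; rewrite !mxE ?N0 ?addr0.
Qed.

Section InclusionOfMatrices.
Variables (R : comNzRingType) (A : algType R) (S : {pred A}) (B : subAlgType S).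

Lemma incl_mx_scale n n' (r : R) (X : 'M[B]_(n, n')) :
  incl_mx (scale_mx r X) = scale_mx r (incl_mx X).
Proof. by apply/matrixP => i j; rewrite !mxE linearZ. Qed.

Lemma incl_ext_mx m d (hd : (d <= m)%N) (p : 'I_(m - d)) (q : 'I_d) n n'
    (P : bmx B m n) (P' : bmx B m n') (X : 'M[B]_(n, n')) :
  incl_bmx (ext_mx hd p q P P' X) =
  bdsum (incl_bmx P) (incl_bmx P') + ext_term hd p q (incl_bmx P') (incl_mx X).
Proof.
rewrite -bdsum_incl; apply/matrixP => i j; rewrite !mxE !summxE.
rewrite [LHS]map_mxD; congr (_ + _).
rewrite (big_morph (map_mx \val) (id1 := 0) (op1 := +%R)).
- apply: eq_bigr => k _; rewrite !mxE; case: (_ && _); last first.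
    by rewrite !mulr0; exact: map_mx0.
  rewrite !mulr1; apply: etrans (map_block_mx _ _ _ _ _) _.
  by rewrite !map_mx0 map_mxM.
- by move=> x y; exact: map_mxD.
- exact: map_mx0.
Qed.

End InclusionOfMatrices.

Lemma scale_mx_mul (R : comNzRingType) (A : algType R) n1 n2 n3 n4 (r : R)
    (Y : 'M[A]_(n1, n2)) (X : 'M[A]_(n2, n3)) (Z : 'M[A]_(n3, n4)) :
  Y *m scale_mx r X *m Z = scale_mx r (Y *m X *m Z).
Proof.
apply/matrixP => i j; rewrite !mxE scaler_sumr; apply: eq_bigr => k _.
rewrite !mxE scalerAl; congr (_ * _).
rewrite scaler_sumr; apply: eq_bigr => l _.
by rewrite !mxE scalerAr.
Qed.

Lemma scale_mxK (R : comNzRingType) (V : lmodType R) n n' (r : R) (X : 'M[V]_(n, n')) :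
  invertible r -> scale_mx (inverse r) (scale_mx r X) = X.
Proof.
move=> /inverseP[_ h]; apply/matrixP => i j.
by rewrite !mxE scalerA h scale1r.
Qed.

Lemma scale_mxN (R : comNzRingType) (V : lmodType R) n n' (r : R) (X : 'M[V]_(n, n')) :
  scale_mx r (- X) = - scale_mx r X.
Proof. by apply/matrixP => i j; rewrite !mxE scalerN. Qed.

(** [X] is arbitrary: applied to [scale_mx r X], this both produces the corner in [ddiff] and
    determines it. *)
Lemma resolvent_gr_ext (R : comNzRingType) (A : algType R) (S : {pred A})
    (B : subAlgType S) (m d : nat) (hd : (d <= m)%N) (s u : 'I_(m - d))
    (t v : 'I_d) (pi : Gr A (leq_subr d m) 1) (n n' : nat)
    (sigma : Gr B hd n) (sigma' : Gr B hd n')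
    (hsigma : resolvent_set B hd pi n sigma)
    (hsigma' : resolvent_set B hd pi n' sigma')
    (X : 'M[B]_(n, n')) :
  resolvent_set B hd pi (n + n') (gr_ext s t sigma sigma' X) ->
  resolvent B hd pi v u (gr_ext s t sigma sigma' X) =
  block_mx (resolvent B hd pi v u sigma)
    (- (resolvent B hd pi v s sigma *m incl_mx X *m resolvent B hd pi t u sigma'))
    0 (resolvent B hd pi v u sigma').
Proof.
have piE := gr_class_repr pi.
have QE := gr_class_repr sigma; have QE' := gr_class_repr sigma'.
move: hsigma hsigma'; rewrite -{1}QE -{1}QE'.
move=> /(resolvent_setP _ _ piE) /inverseP h /(resolvent_setP _ _ piE) /inverseP h'.
(* By independence of representatives, the resolvent is computed on the explicit matrix [ext_mx]
   rather than on the chosen representative of its class. *)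
rewrite /gr_ext => htau; rewrite (resolvent_class _ _ piE htau).
move=> {htau}; rewrite /resolvent /=.
move: h h'; set a := gl_mx (repr pi).
rewrite incl_ext_mx bdsum_iterD.
set Q := incl_bmx (gl_mx (repr sigma)); set Q' := incl_bmx (gl_mx (repr sigma')).
set T := inverse _ => h; set T' := inverse _ => h'.
set N := ext_term _ _ _ _ _.
have NWN : N * bdsum T T' * N = 0 by apply: strict_upper_mul0; exact: ext_term_strict.
rewrite res_mx_addr; last exact: ext_term_first.
rewrite res_mx_bdsum (inverseE (perturb_inverse (bdsum_inverse h h') NWN)).
have bdsumNE j : (bdsum Q Q' + N) (top_ord hd v) j =
    block_mx (Q (top_ord hd v) j) 0 0 (Q' (top_ord hd v) j).
  by rewrite mxE ext_term_top addr0 mxE.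
(* [K] is the [(t, u)] resolvent at [sigma']. *)
set K := \sum_(j < d) Q' (top_ord hd t) (last_ord hd j) *m _.
have invE j : (bdsum T T' - bdsum T T' * N * bdsum T T') j (bot_ord hd u) =
    block_mx (T j (bot_ord hd u))
      (- (T j (bot_ord hd s) *m incl_mx X *m K)) 0 (T' j (bot_ord hd u)).
  rewrite mxE [X in _ + X]mxE ext_term_conj mxE opp_block_mx.
  by rewrite [LHS]add_block_mx !(oppr0, addr0, add0r).
under eq_bigr => j _.
  rewrite bdsumNE invE mulmx_block !(mulmx0, mul0mx, addr0, add0r).
  rewrite mulmxN !mulmxA; over.
(* In the corner, [X] and [K] leave the sum over [j]; what remains is the [(v, s)] resolvent at
   [sigma]. *)
by rewrite sum_block_mx sumrN -!mulmx_suml big1_eq.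
Qed.

Theorem theorem6p1 (R : comNzRingType) (A : algType R) (S : {pred A})
    (B : subAlgType S) (m d : nat) (hm : (0 < m)%N) (hd0 : (0 < d)%N)
    (hd : (d <= m)%N) (s u : 'I_(m - d)) (t v : 'I_d)
    (pi : Gr A (leq_subr d m) 1)
    (hadm : admissible (resolvent_set B hd pi) s t)
    (n n' : nat) (hn : (0 < n)%N) (hn' : (0 < n')%N)
    (sigma : Gr B hd n) (sigma' : Gr B hd n')
    (hsigma : resolvent_set B hd pi n sigma) (hsigma' : resolvent_set B hd pi n' sigma')
    (X : 'M[B]_(n, n')) :
  ddiff (resolvent_set B hd pi) s t (resolvent B hd pi v u) sigma sigma' X =
  - (resolvent B hd pi v s sigma *m incl_mx X *m resolvent B hd pi t u sigma').
Proof.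
rewrite /ddiff; case: xgetP => [_ -> [r [H [hr htau]]] | /(_ _)/= noD].
  (* Whatever [r] and [H] were chosen, comparing corners forces [H], and its factor [r] cancels. *)
  rewrite resolvent_gr_ext // => /eq_block_mx[_ <- _ _] ->.
  by rewrite incl_mx_scale scale_mx_mul scale_mxN scale_mxK.
(* Admissibility rules out the default value 0 of [xget] by supplying a witness. *)
have [r hr htau] := hadm n n' sigma sigma' X hn hn' hsigma hsigma'.
case: (noD (- (resolvent B hd pi v s sigma *m incl_mx X *m resolvent B hd pi t u sigma'))).
exists r; eexists; split=> //; first exact: resolvent_gr_ext.
by rewrite incl_mx_scale scale_mx_mul scale_mxN scale_mxK.
Qed.
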